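(* Let $X$ be a random variable with distribution function $F\in\mathcal H$. Then: (i) $F^\beta\in\mathcal H$ for every $\beta\ge1$; (ii) $\phi(X)\in\mathcal H$ whenever $\phi:\mathbb R_+\to\mathbb R_+$ is a strictly increasing bijection (so $\phi(0)=0$) such that $x\mapsto 1/\phi^{-1}(1/x)$ is concave on $\mathbb R_{++}$; (iii) if $Y$ is independent of $X$ and has distribution function $G\in\mathcal H$, then $\max\{X,Y\}\in\mathcal H$; (iv) if in addition $X$ has a density, and $Y$ is another random variable that has a density and whose distribution has essential infimum $0$, and $X\le_{\rm lr}Y$, then $Y\in\mathcal H$.
   Context: $\mathbb R_+=[0,\infty)$ and $\mathbb R_{++}=(0,\infty)$. For a distribution function $F$, $\overline F=1-F$. ''Increasing'' means non-decreasing unless ''strictly'' is said. Inverted concave: a distribution function $F$ with essential infimum $0$ belongs to $\mathcal H$ if $x\mapsto\overline F(1/x)$ is concave on $\mathbb R_{++}$. For a random variable $X$ with distribution function $F\in\mathcal H$, one also writes $X\in\mathcal H$. Likelihood ratio order: for random variables $X,Y$ with densities $f,g$ respectively, $X\le_{\rm lr}Y$ means that $g(x)/f(x)$ is increasing in $x$ over the union of the supports of $X$ and $Y$ (with $a/0=\infty$ for $a>0$). *)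

(* Defs.v *)
From HB Require Import structures.
From mathcomp Require Import all_boot all_order all_algebra.
From mathcomp Require Import all_classical all_reals all_analysis.
From mathcomp Require Import ess_sup_inf measurable_realfun.

Set Implicit Arguments.
Unset Strict Implicit.
Unset Printing Implicit Defensive.

Import Order.TTheory GRing.Theory Num.Theory.
Import numFieldNormedType.Exports.

Local Open Scope classical_set_scope.
Local Open Scope ring_scope.
Local Open Scope convex_scope.

(** Mirrors the library's [convex_function]. *)
Definition concave_function (R : numFieldType) (E : lmodType R)
    (E' := convex_lmodType E) (D : set E') (f : E' -> R^o) : Prop :=
  forall t : {i01 R},
    {in D &, forall x y : E', (f x <| t |> f y <= f (x <| t |> y))%R}.

Section inverted_concave.
Variable R : realType.

Definition Rplus : set R := `[0, +oo[%classic.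
Definition Rpplus : set R := `]0, +oo[%classic.

(** The witness [G] is [F] packaged as a distribution function (nondecreasing,
    right-continuous, with limits 0 and 1), so that its distribution is the
    associated Lebesgue-Stieltjes measure. *)
Definition inverted_concave (F : R -> R) : Prop :=
  exists G : cumulativeBounded (0 : R) (1 : R),
    [/\ F = G :> (R -> R),
        ess_inf (lebesgue_stieltjes_measure G) (@EFin R) = 0%E &
        concave_function (Rpplus : set R^o) (fun x : R^o => 1 - F x^-1)].

End inverted_concave.

Section random_variables.
Context d (T : measurableType d) (R : realType) (P : probability T R).

Definition rv_inverted_concave (X : {RV P >-> R}) : Prop :=
  inverted_concave (fun x => fine (cdf X x)).

Definition independent_RV (X Y : {RV P >-> R}) : Prop :=
  forall A B : set R, measurable A -> measurable B ->
    P (X @^-1` A `&` Y @^-1` B) = (P (X @^-1` A) * P (Y @^-1` B))%E.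

Definition is_density (X : {RV P >-> R}) (f : R -> R) : Prop :=
  [/\ measurable_fun setT f,
      forall x, 0 <= f x &
      forall A : set R, measurable A ->
        distribution P X A = (\int[lebesgue_measure]_(x in A) (f x)%:E)%E].

End random_variables.

(** Densities are defined up to null sets only, hence the existential
    quantifiers.  The quotient is the one of [\bar R], for which [a / 0 = +oo]
    when [0 < a]; [0 / 0] does not occur since the supports are taken to be the
    sets on which the densities are positive. *)
Definition lr_le d (T : measurableType d) (R : realType) (P : probability T R)
    d' (T' : measurableType d') (P' : probability T' R)
    (X : {RV P >-> R}) (Y : {RV P' >-> R}) : Prop :=
  exists f g : R -> R, [/\ is_density X f, is_density Y g &
    {in [set x | 0 < f x] `|` [set x | 0 < g x] &,
      {homo (fun x => ((g x)%:E / (f x)%:E)%E) :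
        x y / (x <= y)%R >-> (x <= y)%E}}].

(* Main.v *)
Require Import Defs.
From HB Require Import structures.
From mathcomp Require Import all_boot all_order all_algebra.
From mathcomp Require Import all_classical all_reals all_analysis.
From mathcomp Require Import ess_sup_inf measurable_realfun.
From mathcomp Require Import lra.

Import Order.TTheory GRing.Theory Num.Theory.
Import numFieldNormedType.Exports.

Local Open Scope classical_set_scope.
Local Open Scope ring_scope.

(** Write K(y) = F(1/y).  A distribution function F with essential infimum 0
    is inverted concave exactly when K is convex on the positive half-line, and
    K is nonnegative and nonincreasing whatever F is.  The essential infimum
    condition only says that F vanishes on the negative reals and is positive
    on the positive ones ([ess_inf_EFin_eq0P]), so that every claim reduces to
    the convexity of some K, which is what [inverted_concaveP] and
    [rv_inverted_concaveP] express.

    Powers: the map a |-> a^beta is nondecreasing and convex on the nonnegative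
    reals, hence preserves convexity ([inverted_concave_powR]).

    Increasing transformations: the distribution function of phi(X) is
    F o phi^-1, whose K is y |-> K (1 / phi^-1(1/y)), a nonincreasing convex
    function after a concave one ([inverted_convex_comp]).

    Maxima: by independence the distribution function of max(X, Y) is F G, and
    the product of two nonnegative convex functions that vary in the same
    direction is convex ([inverted_convexM]).

    Likelihood ratio: differentiation of F can be avoided.  Monotonicity of
    g / f gives the cross inequality g x * f y <= f x * g y for x <= y, which,
    integrated over x in ]a, b] and y in ]b, c], becomes
      (F c - F b) * (G b - G a) <= (G c - G b) * (F b - F a).
    Convexity of K bounds the increment F b - F a by a multiple of F c - F b;
    the two inequalities give the same bound for G once F c - F b is cancelled.
    The cancellation is legitimate because F is strictly increasing on the
    positive reals ([inverted_concave_lt]): were F flat on [b, c], convexity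
    would make it constant on ]0, b], so that the distribution would have an
    atom at 0, which a density forbids. *)

(** * Almost sure bounds and essential infima *)

Section almost_everywhere.
Context {d} {T : measurableType d} {R : realType}.

(** The event f < 0 is a countable union of events f <= - 1/n. *)
Lemma ae_ge0P (mu : {measure set T -> \bar R}) (f : T -> R) :
  measurable_fun setT f ->
  (\forall w \ae mu, 0 <= f w) <->
  (forall x, x < 0 -> mu (f @^-1` `]-oo, x]) = 0%E).
Proof.
move=> mf.
have mfx x : measurable (f @^-1` `]-oo, x]).
  by rewrite -[X in measurable X]setTI; exact: mf.
split=> [f_ge0 x x0|f0].
  apply/(negligibleP mu (mfx x)); apply: negligibleS f_ge0 => w /=.
  by rewrite in_itv/= => fwx; apply/negP; rewrite -ltNge (le_lt_trans fwx).
have := @negligible_bigcup _ _ _ mu (fun n => f @^-1` `]-oo, - n.+1%:R^-1]) _.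
move=> /(_ (fun n => (negligibleP mu (mfx _)).2 (f0 _ _))) H.
apply: negligibleS (H _) => [w /= /negP|n]; last by rewrite oppr_lt0 invr_gt0.
rewrite -ltNge => fw0; exists (Num.truncn (- f w)^-1) => //=.
rewrite in_itv/= lerNr invf_ple ?posrE ?oppr_gt0//.
by rewrite ltW// truncnS_gt.
Qed.

(** Translates the condition on the essential infimum into values of the
    distribution function; 0 itself is left out, since an atom at 0 may or may
    not be present. *)
Lemma ess_inf_EFin_eq0P (mu : {measure set T -> \bar R}) (f : T -> R) :
  measurable_fun setT f ->
  ess_inf mu (EFin \o f) = 0%E <->
  (forall x, x < 0 -> mu (f @^-1` `]-oo, x]) = 0%E) /\
  (forall x, 0 < x -> (0 < mu (f @^-1` `]-oo, x]))%E).
Proof.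
move=> mf.
have mfx x : measurable (f @^-1` `]-oo, x]).
  by rewrite -[X in measurable X]setTI; exact: mf.
split=> [mu0|[/(ae_ge0P mu f mf) f_ge0 mu_gt0]].
  split; first apply/(ae_ge0P mu f mf).
    have /ess_infP : (0 <= ess_inf mu (EFin \o f))%E by rewrite mu0.
    by apply: filterS => w /=; rewrite lee_fin.
  move=> x x0; rewrite lt0e measure_ge0 andbT; apply/eqP.
  move=> /(negligibleP mu (mfx x)) nx.
  have : (x%:E <= ess_inf mu (EFin \o f))%E.
    apply/ess_infP; apply: negligibleS nx => w /=.
    by rewrite lee_fin in_itv/= => /negP; rewrite -ltNge => /ltW.
  by rewrite mu0 lee_fin leNgt x0.
apply/le_anti/andP; split; last first.
  by apply/ess_infP; apply: filterS f_ge0 => w; rewrite /= lee_fin.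
rewrite leNgt; apply/negP => i_gt0.
have [x x0 xi] : exists2 x : R, 0 < x & (x%:E <= ess_inf mu (EFin \o f))%E.
  case: (ess_inf _ _) i_gt0 => [r r0|_|//]; first by exists r.
  by exists 1 => //; rewrite leey.
have : mu.-negligible (f @^-1` `]-oo, x / 2]).
  move/ess_infP: xi; apply: negligibleS => w /=.
  rewrite lee_fin in_itv/= => + xf; lra.
move=> /(negligibleP mu (mfx _)) mux; have := mu_gt0 (x / 2).
by rewrite mux ltxx divr_gt0// => /(_ isT).
Qed.

Lemma ae_eq_measure (mu : {measure set T -> \bar R}) (A B : set T) :
  measurable A -> measurable B -> (\forall w \ae mu, A w <-> B w) ->
  mu A = mu B.
Proof.
move=> mA mB AB; suff le C D : measurable C -> measurable D ->
    (\forall w \ae mu, C w -> D w) -> (mu C <= mu D)%E.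
  apply/le_anti/andP; split; apply: le => //.
    by apply: filterS AB => w [].
  by apply: filterS AB => w [].
move=> mC mD [N [mN N0 CDN]].
have DN : (mu (D `|` N) <= mu D)%E.
  by rewrite -[leRHS]adde0 -[X in (_ + X)%E]N0; exact: (measureU2 mu mD mN).
apply: le_trans DN.
apply: le_measure; rewrite ?inE//; first exact: measurableU.
move=> w Cw; have [Dw|nDw] := pselect (D w); [by left|right].
by apply: CDN => /= /(_ Cw).
Qed.

End almost_everywhere.

(** * Inverted concavity as convexity of F(1/y) *)

Section inverted_convexity.
Context {R : realType}.
Local Open Scope convex_scope.

(** Convexity of y |-> F (1/y), written with real coefficients so that linear
    arithmetic applies. *)
Definition inverted_convex (F : R -> R) :=
  forall t x y, 0 <= t <= 1 -> 0 < x -> 0 < y ->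
    F (t * x + (1 - t) * y)^-1 <= t * F x^-1 + (1 - t) * F y^-1.

Lemma conv_gt0 (t x y : R) : 0 <= t <= 1 -> 0 < x -> 0 < y ->
  0 < t * x + (1 - t) * y.
Proof.
move=> /andP[t0 t1] x0 y0.
exact: (@convR_gt0 _ x y (Itv01 t0 t1)).
Qed.

Lemma in_Rpplus (x : R) : (x \in @Rpplus R) = (0 < x).
Proof. by rewrite /Rpplus mem_setE in_itv/= andbT. Qed.

Lemma in_Rplus (x : R) : (x \in @Rplus R) = (0 <= x).
Proof. by rewrite /Rplus mem_setE in_itv/= andbT. Qed.

Lemma concave_RpplusP (f : R -> R) :
  concave_function (@Rpplus R : set R^o) f <->
  forall t x y, 0 <= t <= 1 -> 0 < x -> 0 < y ->
    t * f x + (1 - t) * f y <= f (t * x + (1 - t) * y).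
Proof.
split=> [cf t x y /andP[t0 t1] x0 y0|cf t x y].
  have := cf (Itv01 t0 t1) x y; rewrite !in_Rpplus.
  by move=> /(_ x0 y0).
rewrite !in_Rpplus => x0 y0.
by apply: cf => //; rewrite ge0 le1.
Qed.

Lemma inverted_convexP (F : R -> R) :
  concave_function (@Rpplus R : set R^o) (fun x : R^o => 1 - F x^-1) <->
  inverted_convex F.
Proof.
split=> [/concave_RpplusP|] cF.
  by move=> t x y t01 x0 y0; have := cF _ _ _ t01 x0 y0; lra.
by apply/concave_RpplusP => t x y t01 x0 y0; have := cF _ _ _ t01 x0 y0; lra.
Qed.

Lemma lebesgue_stieltjes_itvNyc (G : cumulativeBounded (0 : R) (1 : R)) x :
  lebesgue_stieltjes_measure G `]-oo, x] = (G x)%:E.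
Proof. exact: (cdf_lebesgue_stieltjes_id G x). Qed.

Lemma inverted_concave_cumulativeP (G : cumulativeBounded (0 : R) (1 : R)) :
  inverted_concave G <->
  [/\ forall x, x < 0 -> G x = 0, forall x, 0 < x -> 0 < G x &
      inverted_convex G].
Proof.
have essP (H : cumulativeBounded (0 : R) (1 : R)) :
    ess_inf (lebesgue_stieltjes_measure H) (@EFin R) = 0%E <->
    (forall x, x < 0 -> H x = 0) /\ (forall x, 0 < x -> 0 < H x).
  have := @ess_inf_EFin_eq0P _ _ R (lebesgue_stieltjes_measure H) idfun
    (@measurable_id _ _ setT).
  rewrite /preimage/= => ->; split=> -[H0 H1]; split=> x /[dup] x0.
  - by move/H0; rewrite lebesgue_stieltjes_itvNyc => -[].
  - by move/H1; rewrite lebesgue_stieltjes_itvNyc lte_fin.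
  - by move/H0; rewrite lebesgue_stieltjes_itvNyc => ->.
  - by move/H1; rewrite lebesgue_stieltjes_itvNyc lte_fin.
split=> [[H [GH /essP[H0 H1] /inverted_convexP cG]]|[G0 G1 cG]].
  by rewrite GH in cG *; split.
by exists G; split; [by []|exact/essP|exact/inverted_convexP].
Qed.

(** The limit 0 at -oo comes from F vanishing on the negative reals. *)
Lemma inverted_concaveP (F : R -> R) : inverted_concave F <->
  [/\ {homo F : x y / x <= y}, right_continuous F & F @ +oo --> (1 : R)] /\
  [/\ forall x, x < 0 -> F x = 0, forall x, 0 < x -> 0 < F x &
      inverted_convex F].
Proof.
split=> [hF|[[Fnd Frc F1] [F0 Fgt0 cF]]].
  have [G [FG _ _]] := hF; rewrite FG in hF *.
  have /inverted_concave_cumulativeP[G0 Ggt0 cG] := hF.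
  split; last by split.
  split; [exact: cumulative_is_nondecreasing |
    exact: cumulative_is_right_continuous | exact: cumulativey].
have FNy : F @ -oo --> (0 : R).
  apply: cvg_near_cst; near=> x; apply: F0; near: x.
  exact: nbhs_ninfty_lt.
pose C := isCumulative.Build R _ R F Fnd Frc.
pose B := isCumulativeBounded.Build R 0 1 F FNy F1.
pose G : cumulativeBounded (0 : R) (1 : R) := HB.pack F C B.
by have /inverted_concave_cumulativeP : [/\ forall x, x < 0 -> G x = 0,
  forall x, 0 < x -> 0 < G x & inverted_convex G].
Unshelve. all: by end_near. Qed.

(** The distribution function of a random variable is always monotone,
    right-continuous and normalised, which leaves only the sign conditions and
    the convexity. *)
Lemma rv_inverted_concaveP {d} {T : measurableType d} (P : probability T R)
    (Z : {RV P >-> R}) (F : R -> R) : (forall x, cdf Z x = (F x)%:E) ->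
  rv_inverted_concave Z <->
  [/\ forall x, x < 0 -> F x = 0, forall x, 0 < x -> 0 < F x &
      inverted_convex F].
Proof.
move=> ZF; rewrite /rv_inverted_concave.
have -> : (fun x => fine (cdf Z x)) = F by apply/funext => x; rewrite ZF.
have EF : EFin \o F = cdf Z by apply/funext => x /=; rewrite ZF.
have Fnd : {homo F : x y / x <= y}.
  by move=> x y xy; rewrite -lee_fin -!ZF cdf_nondecreasing.
have Frc : right_continuous F.
  move=> x; have := @cdf_right_continuous _ _ _ _ Z x.
  by rewrite -EF => /fine_cvg.
have Fy : F @ +oo --> (1 : R).
  by have := @cvg_cdfy1 _ _ _ _ Z; rewrite -EF => /fine_cvg.
by split=> [/inverted_concaveP[_]|H] //; apply/inverted_concaveP.
Qed.

End inverted_convexity.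

(** * Stability under powers, products and changes of variable *)

Section closure.
Context {R : realType}.

Lemma inverted_concave_ge0 (F : R -> R) x : inverted_concave F -> 0 <= F x.
Proof.
move=> /inverted_concaveP[[Fnd _ _] [F0 _ _]].
have [x0|x0] := ltP x 0; first by rewrite F0.
by rewrite -(F0 (-1)) ?ltrN10// Fnd// (le_trans _ x0)// lerN10.
Qed.

Lemma inverted_concave_le1 (F : R -> R) x : inverted_concave F -> F x <= 1.
Proof.
move=> /inverted_concaveP[[Fnd _ Fy] _]; rewrite leNgt; apply/negP => Fx.
have Fxy : \forall y \near +oo, F y < F x by exact: cvgr_lt Fy _ Fx.
have [y [Fyx xy]] := filter_ex (filterI Fxy (nbhs_pinfty_ge (num_real x))).
by move: Fyx; rewrite ltNge Fnd.
Qed.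

Lemma powR_continuous_gt0 (beta a : R) : 0 < a ->
  b `^ beta @[b --> a] --> a `^ beta.
Proof.
move=> a0.
suff /differentiable_continuous :
    differentiable (fun b : R => b `^ beta) a by [].
by apply/derivable1_diffP; apply: derivable_powR; rewrite in_itv/= andbT.
Qed.

Lemma inverted_concave_powR (F : R -> R) (beta : R) : 1 <= beta ->
  inverted_concave F -> inverted_concave (fun x => F x `^ beta).
Proof.
move=> beta1 hF; have beta0 : 0 < beta by exact: lt_le_trans beta1.
have F_ge0 x := inverted_concave_ge0 F x hF.
have F_le1 x := inverted_concave_le1 F x hF.
have /inverted_concaveP[[Fnd Frc Fy] [F0 Fgt0 cF]] := hF.
apply/inverted_concaveP; split; split.
- by move=> x y xy; rewrite ge0_ler_powR ?(ltW beta0)// ?nnegrE// Fnd.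
- (* The power function need not be left-continuous at 0, because negative
     bases are sent to 1; where F x = 0 it is squeezed by a^beta <= a on
     [0, 1]. *)
  move=> x; have := F_ge0 x; rewrite le_eqVlt => /predU1P[Fx0|Fx0]; last first.
    exact: cvg_comp (Frc x) (powR_continuous_gt0 beta (F x) Fx0).
  rewrite -Fx0 powR0 ?gt_eqF//; have := Frc x; rewrite -Fx0 => FxN0.
  apply: (@squeeze_cvgr _ _ _ _ (cst 0) F) => //; last exact: cvg_cst.
  apply: nearW => y; rewrite powR_ge0/=.
  have := F_ge0 y; rewrite le_eqVlt => /predU1P[<-|Fy0].
    by rewrite powR0 ?gt_eqF.
  by rewrite ge1r_powR// Fy0 F_le1.
- have -> : 1 = 1 `^ beta :> R by rewrite powR1.
  exact: cvg_comp Fy (powR_continuous_gt0 beta 1 ltr01).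
- by move=> x x0; rewrite F0// powR0// gt_eqF.
- by move=> x x0; rewrite powR_gt0// Fgt0.
- move=> t x y t01 x0 y0; have /andP[t0 t1] := t01.
  have xy0 : 0 <= t * F x^-1 + (1 - t) * F y^-1.
    by rewrite addr_ge0// mulr_ge0// subr_ge0.
  apply: le_trans (ge0_ler_powR (ltW beta0) _ _ (cF _ _ _ t01 x0 y0)) _;
    rewrite ?nnegrE//.
  have := @convex_powR R beta beta1 (Itv01 t0 t1) (F x^-1) (F y^-1).
  by rewrite !in_Rplus; apply.
Qed.

(** Chebyshev's inequality: F(1/x) - F(1/y) and G(1/x) - G(1/y) have the same
    sign, and t (1 - t) times their product is the defect of convexity of the
    product of the two chords. *)
Lemma inverted_convexM (F G : R -> R) :
  {homo F : x y / x <= y} -> {homo G : x y / x <= y} ->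
  (forall x, 0 <= F x) -> (forall x, 0 <= G x) ->
  inverted_convex F -> inverted_convex G ->
  inverted_convex (fun x => F x * G x).
Proof.
move=> Fnd Gnd F0 G0 cF cG t x y t01 x0 y0; have /andP[t0 t1] := t01.
apply: le_trans (ler_pM (F0 _) (G0 _) (cF _ _ _ t01 x0 y0)
  (cG _ _ _ t01 x0 y0)) _.
have FG : 0 <= (F x^-1 - F y^-1) * (G x^-1 - G y^-1).
  have [xy|/ltW xy] := leP x y.
    by rewrite mulr_ge0// subr_ge0 ?(Fnd,Gnd)// lef_pV2.
  by rewrite mulr_le0// subr_le0 ?(Fnd,Gnd)// lef_pV2.
have : 0 <= t * (1 - t) * ((F x^-1 - F y^-1) * (G x^-1 - G y^-1)).
  by rewrite mulr_ge0// mulr_ge0// subr_ge0.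
lra.
Qed.

(** A nonincreasing convex function composed with a concave one is convex;
    here the concave function is y |-> 1 / psi(1/y). *)
Lemma inverted_convex_comp (F psi : R -> R) :
  {homo F : x y / x <= y} -> inverted_convex F ->
  (forall x, 0 < x -> 0 < psi x) ->
  concave_function (@Rpplus R : set R^o) (fun x : R^o => (psi x^-1)^-1) ->
  inverted_convex (F \o psi).
Proof.
move=> Fnd cF psi_gt0 /concave_RpplusP cpsi t x y t01 x0 y0 /=.
have psi'_gt0 z : 0 < z -> 0 < (psi z^-1)^-1.
  by move=> z0; rewrite invr_gt0 psi_gt0// invr_gt0.
have := cF _ _ _ t01 (psi'_gt0 _ x0) (psi'_gt0 _ y0).
rewrite !invrK; apply: le_trans; apply: Fnd.
rewrite -[leLHS]invrK lef_pV2 ?posrE ?cpsi//.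
  by rewrite psi'_gt0// conv_gt0.
by rewrite conv_gt0// psi'_gt0.
Qed.

End closure.

(** * Maxima and images of random variables *)

Section random_variables.
Context {R : realType} {d} {T : measurableType d} (P : probability T R).

Lemma cdf_max (X Y : {RV P >-> R}) x : independent_RV X Y ->
  cdf (X \max Y : {RV P >-> R}) x = (cdf X x * cdf Y x)%E.
Proof.
move=> XY; rewrite /cdf /distribution /pushforward -XY//; congr (P _).
apply/seteqP; split=> w /=; rewrite !in_itv/= ge_max; first by move/andP.
by move=> [-> ->].
Qed.

Lemma max_inverted_concave (X Y : {RV P >-> R}) (F G : R -> R) :
  (forall x, cdf X x = (F x)%:E) -> (forall x, cdf Y x = (G x)%:E) ->
  independent_RV X Y -> inverted_concave F -> inverted_concave G ->
  rv_inverted_concave (X \max Y : {RV P >-> R}).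
Proof.
move=> XF YG XY hF hG.
have FG x : cdf (X \max Y : {RV P >-> R}) x = (F x * G x)%:E.
  by rewrite cdf_max// XF YG.
apply/(rv_inverted_concaveP _ _ _ FG).
have /inverted_concaveP[[Fnd _ _] [F0 Fgt0 cF]] := hF.
have /inverted_concaveP[[Gnd _ _] [G0 Ggt0 cG]] := hG.
split.
- by move=> x x0; rewrite F0// mul0r.
- by move=> x x0; rewrite mulr_gt0 ?Fgt0 ?Ggt0.
- by apply: inverted_convexM => // x; apply: inverted_concave_ge0.
Qed.

Lemma inverted_concave_ae_ge0 (X : {RV P >-> R}) (F : R -> R) :
  (forall x, cdf X x = (F x)%:E) -> inverted_concave F ->
  \forall w \ae P, 0 <= X w.
Proof.
move=> XF /inverted_concaveP[_ [F0 _ _]].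
apply/(ae_ge0P P X (@measurable_funPT _ _ _ _ X)) => x x0.
by have := XF x; rewrite F0.
Qed.

(** Nothing is known of phi on the negative reals, so phi(X) itself may fail to
    be measurable; x |-> phi (max x 0) is monotone, hence measurable, and gives
    almost surely the same values. *)
Lemma exists_ae_eq_comp (X : {RV P >-> R}) (phi : R -> R) :
  {in @Rplus R &, {homo phi : x y / x <= y}} ->
  (\forall w \ae P, 0 <= X w) ->
  exists Z : {RV P >-> R}, \forall w \ae P, Z w = phi (X w).
Proof.
move=> phi_nd X_ge0; pose phi0 x := phi (Num.max x 0).
have mphi : measurable_fun setT phi0.
  apply: nondecreasing_measurable => // x y xy.
  have max_ge0 z : Num.max z 0 \in @Rplus R.
    by rewrite in_Rplus le_max lexx orbT.
  by apply: phi_nd => //; rewrite ge_max !le_max xy lexx orbT.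
have mZ : measurable_fun setT (phi0 \o X) by exact: measurableT_comp.
pose C := isMeasurableFun.Build _ _ _ _ (phi0 \o X) mZ.
pose Z : {RV P >-> R} := HB.pack (phi0 \o X) C.
by exists Z; apply: filterS X_ge0 => w Xw /=; rewrite /phi0 max_l.
Qed.

Lemma cdf_ae_comp (X Z : {RV P >-> R}) (phi : R -> R) x y :
  {in @Rplus R &, {mono phi : x y / x <= y}} ->
  (\forall w \ae P, 0 <= X w) -> (\forall w \ae P, Z w = phi (X w)) ->
  0 <= x -> phi x = y -> cdf Z y = cdf X x.
Proof.
move=> phi_mono X_ge0 ZX x0 <-.
rewrite /cdf /distribution /pushforward.
apply: ae_eq_measure; try exact: measurable_funPTI.
apply: filterS2 X_ge0 ZX => w Xw /= ->.
by rewrite !in_itv/= phi_mono ?in_Rplus.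
Qed.

Lemma comp_inverted_concave (X : {RV P >-> R}) (F phi : R -> R) :
  (forall x, cdf X x = (F x)%:E) -> inverted_concave F ->
  set_bij (@Rplus R) (@Rplus R) phi ->
  {in @Rplus R &, {mono phi : x y / x <= y}} ->
  concave_function (@Rpplus R : set R^o)
    (fun x : R^o => ('pinv_(fun=> 0) (@Rplus R) phi x^-1)^-1) ->
  forall Z : {RV P >-> R}, (\forall w \ae P, Z w = phi (X w)) ->
  rv_inverted_concave Z.
Proof.
move=> XF hF phi_bij phi_mono cpsi Z ZX.
have X_ge0 := inverted_concave_ae_ge0 X F XF hF.
have /inverted_concaveP[[Fnd _ _] [F0 Fgt0 cF]] := hF.
set psi := 'pinv_(fun=> 0) (@Rplus R) phi in cpsi.
have [phi_fun _ phi_surj] := phi_bij.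
have phi_ge0 x : 0 <= x -> 0 <= phi x.
  move=> x0; rewrite -in_Rplus inE; apply: phi_fun; apply/set_mem.
  by rewrite in_Rplus.
have psiK x : 0 <= x -> phi (psi x) = x.
  by move=> x0; apply: (surjpK (fun=> 0) phi_surj); rewrite in_Rplus.
have psi_ge0 x : 0 <= x -> 0 <= psi x.
  move=> x0; rewrite -in_Rplus inE.
  have [psi_fun _ _] := bijpinv_bij (fun=> 0) phi_bij.
  by apply: psi_fun; apply/set_mem; rewrite in_Rplus.
have psi_gt0 x : 0 < x -> 0 < psi x.
  move=> x0; rewrite lt0r psi_ge0 ?(ltW x0)// andbT; apply/eqP => psix.
  have : phi (psi x) <= phi (psi 0).
    by rewrite phi_mono ?in_Rplus ?psi_ge0 ?(ltW x0)// psix psi_ge0.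
  by rewrite !psiK ?(ltW x0)// leNgt x0.
have ZF x : cdf Z x = (if x < 0 then 0 else F (psi x))%:E.
  case: ltP => [x0|x0]; last first.
    by rewrite (cdf_ae_comp X Z phi (psi x) x) ?psi_ge0 ?psiK.
  have Z_ge0 : \forall w \ae P, 0 <= Z w.
    by apply: filterS2 X_ge0 ZX => w Xw /= ->; exact: phi_ge0.
  exact: (ae_ge0P P Z (@measurable_funPT _ _ _ _ Z)).1.
apply/(rv_inverted_concaveP _ _ _ ZF); split.
- by move=> x ->.
- by move=> x x0; rewrite (lt_gtF x0) Fgt0// psi_gt0.
- move=> t x y t01 x0 y0; have invF z : 0 < z -> z^-1 < 0 = false.
    by move=> z0; rewrite lt_gtF// invr_gt0.
  rewrite !invF ?conv_gt0//.
  exact: (inverted_convex_comp F psi Fnd cF psi_gt0 cpsi).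
Qed.

End random_variables.

(** * Likelihood ratio order *)

Section likelihood_ratio.
Context {R : realType}.

Lemma cdf_itvoc {d} {T : measurableType d} (P : probability T R)
    (X : {RV P >-> R}) (F : R -> R) a b :
  (forall x, cdf X x = (F x)%:E) -> a <= b ->
  distribution P X `]a, b]%classic = (F b - F a)%:E.
Proof.
move=> XF ab.
have -> : `]a, b]%classic = `]-oo, b] `\` `]-oo, a].
  by rewrite -[RHS]setCK setCD setCitvl setUC -[LHS]setCK setCitv.
rewrite measureD//= ?setIidr; last 2 first.
- exact: subset_itvl.
- by rewrite (le_lt_trans (probability_le1 _ _)) ?ltry.
by rewrite EFinB -!XF.
Qed.

Lemma ler_density_increments {d} {T : measurableType d} (P : probability T R)
    (X : {RV P >-> R}) {d'} {T' : measurableType d'} (Q : probability T' R)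
    (Y : {RV Q >-> R}) (F G f g : R -> R) (k l a b : R) :
  (forall x, cdf X x = (F x)%:E) -> (forall x, cdf Y x = (G x)%:E) ->
  is_density X f -> is_density Y g -> 0 <= k -> 0 <= l -> a <= b ->
  (forall x, a < x <= b -> k * f x <= l * g x) ->
  k * (F b - F a) <= l * (G b - G a).
Proof.
move=> XF YG [mf f0 Xf] [mg g0 Yg] k0 l0 ab fg.
rewrite -lee_fin !EFinM -(cdf_itvoc _ X)// -(cdf_itvoc _ Y)// Xf// Yg//.
rewrite -!ge0_integralZl//; try by [move=> x _; rewrite lee_fin|
  apply/measurable_EFinP; exact: measurable_funTS].
have mM (m : R) (h : R -> R) : measurable_fun setT h ->
    measurable_fun `]a, b] (fun x : R => (m%:E * (h x)%:E)%E).
  by move=> mh; apply/measurable_EFinP/measurable_funTS/measurable_funM.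
apply: ge0_le_integral => //; try exact: mM.
by move=> x _; rewrite lee_fin mulr_ge0.
Qed.

(** Outside the supports both sides vanish; the value +oo of the ratio at x with
    f x = 0 < g x is incompatible with a finite ratio at a later y. *)
Lemma ratio_homo_cross (f g : R -> R) (x y : R) :
  (forall z, 0 <= f z) -> (forall z, 0 <= g z) ->
  {in [set x | 0 < f x] `|` [set x | 0 < g x] &,
    {homo (fun x => ((g x)%:E / (f x)%:E)%E) : x y / x <= y >-> (x <= y)%E}} ->
  x <= y -> g x * f y <= f x * g y.
Proof.
move=> f0 g0 fg xy; have := f0 y; rewrite le_eqVlt => /predU1P[<-|fy].
  by rewrite mulr0 mulr_ge0.
have := g0 x; rewrite le_eqVlt => /predU1P[<-|gx].
  by rewrite mul0r mulr_ge0.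
have := fg x y; rewrite !inE/= => /(_ (or_intror gx) (or_introl fy) xy).
rewrite (inver (f y)) gt_eqF// inver.
have := f0 x; rewrite le_eqVlt => /predU1P[<-|fx].
  by rewrite eqxx mulry gtr0_sg// mul1e leye_eq.
by rewrite gt_eqF// -!EFinM lee_fin ler_pdivrMr// mulrAC ler_pdivlMr//
  [f x * _]mulrC.
Qed.

Lemma density_no_atom {d} {T : measurableType d} (P : probability T R)
    (X : {RV P >-> R}) (f : R -> R) x :
  is_density X f -> distribution P X [set x] = 0%E.
Proof. by move=> [_ _ ->//]; rewrite integral_set1. Qed.

(** A convex nonincreasing K that is flat somewhere stays constant from there
    on, so a flat piece of F on [b, c] extends to ]0, b] and, by
    right-continuity, to 0; but F 0 = 0 in the absence of an atom. *)
Lemma inverted_concave_lt {d} {T : measurableType d} (P : probability T R)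
    (X : {RV P >-> R}) (F f : R -> R) (b c : R) :
  (forall x, cdf X x = (F x)%:E) -> inverted_concave F -> is_density X f ->
  0 < b -> b < c -> F b < F c.
Proof.
move=> XF hF Xf b0 bc; have c0 := lt_trans b0 bc.
have /inverted_concaveP[[Fnd Frc _] [F0 Fgt0 cF]] := hF.
rewrite ltNge; apply/negP => Fcb.
have Fle x : 0 < x < b -> F b <= F x.
  move=> /andP[x0 xb].
  have xc : x < c := lt_trans xb bc.
  have cx : 0 < x^-1 - c^-1 by rewrite subr_gt0 ltf_pV2.
  (* t is the weight for which 1/b = t / c + (1 - t) / x. *)
  pose t := (x^-1 - b^-1) / (x^-1 - c^-1).
  have t0 : 0 <= t by rewrite divr_ge0 ?(ltW cx)// subr_ge0 lef_pV2// ltW.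
  have t1 : t < 1.
    by rewrite ltr_pdivrMr// mul1r ltrD2l ltrN2 ltf_pV2.
  have := cF t c^-1 x^-1; rewrite t0 (ltW t1) !invr_gt0 => /(_ isT c0 x0).
  have -> : t * c^-1 + (1 - t) * x^-1 = b^-1.
    have : t * (x^-1 - c^-1) = x^-1 - b^-1 by rewrite divfK ?gt_eqF.
    lra.
  rewrite !invrK => H.
  have : (1 - t) * F b <= (1 - t) * F x by nra.
  by rewrite ler_pM2l// subr_gt0.
have F00 : F 0 = 0.
  have X_ge0 := inverted_concave_ae_ge0 P X F XF hF.
  apply/EFin_inj; rewrite -XF; apply: etrans (density_no_atom P X f 0 Xf).
  rewrite /cdf /distribution /pushforward.
  apply: ae_eq_measure; try exact: measurable_funPTI.
  apply: filterS X_ge0 => w /= Xw; rewrite in_itv/=; split=> [wX|->//].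
  by apply/le_anti/andP.
have F0b : F 0 < F b by rewrite F00 Fgt0.
have F_lt : \forall x \near 0^'+, F x < F b by exact: cvgr_lt (Frc 0) _ F0b.
have Fxb : \forall x \near 0^'+, F x < F b /\ 0 < x < b.
  by apply: filterS3 F_lt (nbhs_right_gt 0) (nbhs_right_lt b0) => x -> -> ->.
have [x [Fxb0 /Fle]] := @filter_ex _ _ (at_right_proper_filter 0) _ Fxb.
by rewrite leNgt Fxb0.
Qed.

(** Integrated form of the cross inequality, combined with the strict increase
    of F to transfer the convexity of F(1/y) to G(1/y). *)
Lemma lr_le_inverted_concave {d} {T : measurableType d} (P : probability T R)
    (X : {RV P >-> R}) {d'} {T' : measurableType d'} (Q : probability T' R)
    (Y : {RV Q >-> R}) (F : R -> R) :
  (forall x, cdf X x = (F x)%:E) -> inverted_concave F ->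
  ess_inf (distribution Q Y) (@EFin R) = 0%E -> lr_le X Y ->
  rv_inverted_concave Y.
Proof.
move=> XF hF Y0 [f [g [Xf Yg fg]]].
pose G x := fine (cdf Y x).
have YG x : cdf Y x = (G x)%:E by rewrite /G fineK// fin_num_measure.
have /inverted_concaveP[[Fnd _ _] [_ _ cF]] := hF.
have [_ f0 _] := Xf; have [_ g0 _] := Yg.
apply/(rv_inverted_concaveP _ _ _ YG).
have := (ess_inf_EFin_eq0P (distribution Q Y) idfun
  (@measurable_id _ _ setT)).1 Y0.
rewrite /preimage/= => -[G0 Ggt0]; split.
- by move=> x /G0; rewrite -/(cdf Y x) YG => -[].
- by move=> x /Ggt0; rewrite -/(cdf Y x) YG lte_fin.
have cross a b c : a <= b -> b <= c ->
    (F c - F b) * (G b - G a) <= (G c - G b) * (F b - F a).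
  move=> ab bc.
  apply: (ler_density_increments Q Y P X _ _ _ _ _ _ _ _ YG XF Yg Xf _ _ ab).
  - by rewrite subr_ge0 Fnd.
  - by rewrite subr_ge0 -lee_fin -!YG cdf_nondecreasing.
  move=> x /andP[_ xb]; rewrite mulrC [leRHS]mulrC.
  apply: (ler_density_increments P X Q Y _ _ _ _ _ _ _ _ XF YG Xf Yg _ _ bc)
    => //.
  move=> y /andP[bY _].
  by apply: ratio_homo_cross => //; exact: le_trans xb (ltW bY).
have convex_le t x y : 0 <= t <= 1 -> 0 < x -> 0 < y -> x <= y ->
    G (t * x + (1 - t) * y)^-1 <= t * G x^-1 + (1 - t) * G y^-1.
  move=> t01 x0 y0 xy; have m0 := conv_gt0 t x y t01 x0 y0.
  have /andP[t0 t1] := t01.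
  set m := t * x + (1 - t) * y in m0 *.
  have xm : x <= m by rewrite /m; nra.
  have my : m <= y by rewrite /m; nra.
  (* m = x leaves no increment of F to cancel, but then t = 1 or x = y. *)
  have := xm; rewrite le_eqVlt => /predU1P[xmE|xm'].
    rewrite -xmE; have : (1 - t) * (y - x) = 0 by move: xmE; rewrite /m; lra.
    move=> /eqP; rewrite mulf_eq0 => /orP[/eqP t1E|]; last first.
      by rewrite subr_eq0 => /eqP ->; lra.
    have -> : t = 1 by lra.
    by lra.
  have FF : F m^-1 < F x^-1.
    by apply: (inverted_concave_lt P X F f) => //; rewrite ?invr_gt0// ltf_pV2.
  have FG : (F x^-1 - F m^-1) * (G m^-1 - G y^-1) <=
            (G x^-1 - G m^-1) * (F m^-1 - F y^-1).
    by apply: cross; rewrite lef_pV2.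
  have cFm := cF t x y t01 x0 y0; rewrite -/m in cFm.
  have Gxm : 0 <= G x^-1 - G m^-1.
    by rewrite subr_ge0 -lee_fin -!YG cdf_nondecreasing// lef_pV2.
  suff : (F x^-1 - F m^-1) * ((1 - t) * (G m^-1 - G y^-1)) <=
         (F x^-1 - F m^-1) * (t * (G x^-1 - G m^-1)).
    by rewrite ler_pM2l ?subr_gt0//; lra.
  have H1 : (1 - t) * (F m^-1 - F y^-1) <= t * (F x^-1 - F m^-1) by lra.
  have H2 := ler_wpM2l Gxm H1.
  have t1' : 0 <= 1 - t by rewrite subr_ge0.
  have H3 := ler_wpM2l t1' FG.
  lra.
move=> t x y t01 x0 y0; have [xy|/ltW yx] := leP x y; first exact: convex_le.
have /andP[t0 t1] := t01.
have := convex_le (1 - t) y x.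
rewrite subr_ge0 gerBl t0 t1 => /(_ isT y0 x0 yx).
by rewrite subKr addrC [leRHS]addrC.
Qed.

End likelihood_ratio.

Theorem proposition4 (R : realType) (d : measure_display)
    (T : measurableType d) (P : probability T R)
    (X : {RV P >-> R}) (F : R -> R)
    (hXF : forall x : R, cdf X x = (F x)%:E)
    (hF : inverted_concave F) :
  [/\ (* (i) *)
      forall beta : R, 1 <= beta ->
        inverted_concave (fun x : R => F x `^ beta),
      (* (ii) : phi(X) is any random variable equal to phi o X almost surely *)
      forall phi : R -> R,
        set_bij (@Rplus R) (@Rplus R) phi ->
        {in @Rplus R &, {homo phi : x y / x < y}} ->
        concave_function (@Rpplus R : set R^o)
          (fun x : R^o => ('pinv_(fun=> 0) (@Rplus R) phi x^-1)^-1) ->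
        (exists Z : {RV P >-> R}, \forall w \ae P, Z w = phi (X w)) /\
        (forall Z : {RV P >-> R}, (\forall w \ae P, Z w = phi (X w)) ->
          rv_inverted_concave Z),
      (* (iii) *)
      forall (Y : {RV P >-> R}) (G : R -> R),
        independent_RV X Y ->
        (forall x : R, cdf Y x = (G x)%:E) ->
        inverted_concave G ->
        rv_inverted_concave (X \max Y : {RV P >-> R}) &
      (* (iv) *)
      forall (d' : measure_display) (T' : measurableType d')
        (P' : probability T' R) (Y : {RV P' >-> R}),
        (exists f : R -> R, is_density X f) ->
        (exists g : R -> R, is_density Y g) ->
        ess_inf (distribution P' Y) (@EFin R) = 0%E ->
        lr_le X Y ->
        rv_inverted_concave Y].
Proof.
split.
- by move=> beta beta1; exact: inverted_concave_powR.
- move=> phi phi_bij phi_incr phi_concave.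
  have phi_mono := le_mono_in phi_incr.
  split; last first.
    exact: comp_inverted_concave P X F phi hXF hF phi_bij phi_mono phi_concave.
  apply: exists_ae_eq_comp; last exact: inverted_concave_ae_ge0 P X F hXF hF.
  by move=> x y x0 y0; rewrite phi_mono.
- move=> Y G XY hYG hG.
  exact: max_inverted_concave P X Y F G hXF hYG XY hF hG.
- move=> d' T' P' Y _ _ Y0 XY.
  exact (lr_le_inverted_concave P X P' Y F hXF hF Y0 XY).
Qed.
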